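(* Let $Y=\{\mathbf y^{(1)},\dots,\mathbf y^{(n)}\}\in(\mathbb R^m)^n$ be a finite approximation set and $\mathbf Y=\operatorname{concat}(Y)$. Then $$\frac{\partial^2\mathcal H}{\partial y^{(i)}_k\partial y^{(i)}_k}=0,\qquad i\in\{1,\dots,n\},\ k\in\{1,\dots,m\},\ m\in\mathbb N_{>0}.$$ For $l\ne k$, let $$Y'=\{\mathbf y^{(i)}_{-k}\}\cup\{\mathbf y^{(\alpha)}_{-k}:\alpha\in I(Y,i,k)\},$$ let $p=l$ if $l<k$ and $p=l-1$ otherwise (so that $y^{(i)}_l$ is the $p$-th component of $\mathbf y^{(i)}_{-k}$), and take the index set $I(Y',i,l)=\{\alpha\in\{1,\dots,|Y'|\}: y^{(\alpha)}_l<y^{(i)}_l\}$, where $\alpha$ indexes the points $\mathbf y^{(\alpha)}_{-k}$ of $Y'$. Then, by recursively applying to $Y'$ the first-derivative formula recalled in the context, $$\frac{\partial^2\mathcal H}{\partial y^{(i)}_l\partial y^{(i)}_k}=\operatorname{HVC}\Big(\operatorname{proj}_p(\mathbf y^{(i)}_{-k}),\ \{\operatorname{proj}_p(\mathbf y^{(\alpha)}_{-k}):\alpha\in I(Y',i,l)\}\Big),$$ which is an $(m-2)$-dimensional Lebesgue measure.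
   Context: Minimization is considered, with a fixed reference point $\mathbf r\in\mathbb R^m$. An approximation set is a finite collection of points of the objective space $\mathbb R^m$. For vectors of equal dimension, $\mathbf p\prec\mathbf q$ (''$\mathbf p$ dominates $\mathbf q$'') means $p_i<q_i$ for all $i$. The hypervolume indicator of a finite $Y\subset\mathbb R^m$ is $\operatorname{HV}(Y)=\lambda_m(\{\mathbf p\in\mathbb R^m: \exists \mathbf y\in Y,\ \mathbf y\prec\mathbf p\prec\mathbf r\})$, with $\lambda_m$ the $m$-dimensional Lebesgue measure. The map $\operatorname{concat}$ sends $(\mathbf y^{(1)},\dots,\mathbf y^{(n)})$ to $\mathbf Y=(y^{(1)}_1,\dots,y^{(1)}_m,\dots,y^{(n)}_1,\dots,y^{(n)}_m)^\top\in\mathbb R^{nm}$, and $\mathcal H=\operatorname{HV}\circ\operatorname{concat}^{-1}:\mathbb R^{nm}\to\mathbb R_{\ge0}$. The operator $\operatorname{proj}_k$ drops the $k$-th component of a vector (of any dimension), $\mathbf y^{(\alpha)}_{-k}=\operatorname{proj}_k(\mathbf y^{(\alpha)})$, and $I(Y,i,k)=\{\alpha\in\{1,\dots,n\}:y^{(\alpha)}_k<y^{(i)}_k\}$. In projected spaces the reference point is projected accordingly. The hypervolume contribution of a point $\mathbf y$ to a finite point set $P$ in the same space, of dimension $q$, is $$\operatorname{HVC}(\mathbf y,P)=\operatorname{HV}(P\cup\{\mathbf y\})-\operatorname{HV}(P)=\lambda_{q}\Big(\operatorname{Dom}_q(\mathbf y)\setminus\bigcup_{\mathbf p\in P}\operatorname{Dom}_q(\mathbf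 p)\Big),$$ where $\operatorname{Dom}_q(\mathbf y)$ is the set of $\mathbf p\in\mathbb R^q$ that are dominated by $\mathbf y$ and dominate the (projected) reference point. The first-derivative formula is $\partial\mathcal H(\mathbf Y)/\partial y^{(i)}_k=-\operatorname{HVC}(\mathbf y^{(i)}_{-k},\{\mathbf y^{(\alpha)}_{-k}:\alpha\in I(Y,i,k)\})$.
   Formalization: The formulas are asserted wherever the second partial derivative exists; existence is proved if the coordinates differentiated are shared with no other point nor with r. The mixed formula also assumes y^(i)_k ≤ r_k and y^(i)_l ≤ r_l; without these conditions the claim is false. *)

(* Defs.v *)
From HB Require Import structures.
From mathcomp Require Import all_boot all_order all_algebra.
From mathcomp Require Import all_classical all_reals all_analysis.
From mathcomp Require Import measurable_realfun.
Set Implicit Arguments.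
Unset Strict Implicit.
Unset Printing Implicit Defensive.
Import Order.TTheory GRing.Theory Num.Theory.
Import numFieldNormedType.Exports.
Local Open Scope classical_set_scope.
Local Open Scope ring_scope.

(* A vector of R^q is a row vector 'rV[R]_q; an n-tuple of points of R^m is
   the matrix Y : 'M[R]_(n, m) whose i-th row is y^(i). Components and points
   are numbered from 0. *)

(* Iterated-integral (product measure) form of the q-dimensional Lebesgue
   measure; it is only meant for Borel sets. On R^0, a single point, it is the
   Dirac mass. *)
Fixpoint lebesgue_rV (R : realType) (q : nat) : set 'rV[R]_q -> \bar R :=
  match q with
  | 0 => fun A => (\1_A 0)%:E
  | q'.+1 => fun A =>
      (\int[lebesgue_measure]_(x in [set: R])
         lebesgue_rV [set v : 'rV[R]_q' | A (row_mx (x%:M : 'rV[R]_1) v)])%E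
  end.

Section Hypervolume.
Context {R : realType}.

Definition dominates q (x y : 'rV[R]_q) : Prop := forall j, x 0 j < y 0 j.

Definition Dom q (r y : 'rV[R]_q) : set 'rV[R]_q :=
  [set x | dominates y x /\ dominates x r].

(* The measured set lies in a box when P is finite, so [fine] loses nothing. *)
Definition HV q (r : 'rV[R]_q) (P : set 'rV[R]_q) : R :=
  fine (lebesgue_rV
    [set x | exists y, [/\ P y, dominates y x & dominates x r]]).

Definition HVC q (r y : 'rV[R]_q) (P : set 'rV[R]_q) : R :=
  HV r (P `|` [set y]) - HV r P.

(* mxvec lists the entries of a matrix row by row. *)
Definition concat n m (Y : 'M[R]_(n, m)) : 'rV[R]_(n * m) := mxvec Y.

Definition points n m (Y : 'M[R]_(n, m)) : set 'rV[R]_m :=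
  range (fun i => row i Y).

Definition calH n m (r : 'rV[R]_m) (Z : 'rV[R]_(n * m)) : R :=
  HV r (points (vec_mx Z)).

Definition coord_dir n m (i : 'I_n) (k : 'I_m) : 'rV[R]_(n * m) :=
  delta_mx 0 (mxvec_index i k).

(* The partial derivative of F with respect to y^(i)_k, as a function; it is
   meaningful only where F is derivable along coord_dir i k. *)
Definition partial n m (i : 'I_n) (k : 'I_m) (F : 'rV[R]_(n * m) -> R)
  : 'rV[R]_(n * m) -> R := fun Z => 'D_(coord_dir i k) F Z.

(* d^2 F / dy^(j)_l dy^(i)_k exists at Z: the inner partial derivative exists
   on the l-line of y^(j) around Z and is derivable along it at Z. *)
Definition derivable2 n m (j : 'I_n) (l : 'I_m) (i : 'I_n) (k : 'I_m)
    (F : 'rV[R]_(n * m) -> R) (Z : 'rV[R]_(n * m)) : Prop :=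
  (\forall t \near (0 : R),
     derivable F (Z + t *: coord_dir j l) (coord_dir i k)) /\
  derivable (partial i k F) Z (coord_dir j l).

(* I(Y, i, k), for the family of the points y a with a in the index set J. *)
Definition below n q (J : {set 'I_n}) (y : 'I_n -> 'rV[R]_q)
    (i : 'I_n) (k : 'I_q) : {set 'I_n} :=
  [set a in J | y a 0 k < y i 0 k]%SET.

(* The k-th component of y^(i) is shared neither with another point nor with
   the reference point. *)
Definition generic_at n m (r : 'rV[R]_m) (Y : 'M[R]_(n, m))
    (i : 'I_n) (k : 'I_m) : Prop :=
  Y i k != r 0 k /\ forall a, a != i -> Y a k != Y i k.

End Hypervolume.

Lemma lebesgue_rV0 (R : realType) q : @lebesgue_rV R q set0 = 0%E.
Proof.
elim: q => [|q IH] /=; first by rewrite indic0.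
by under eq_integral do rewrite IH; rewrite integral0.
Qed.
(* Normalization check: boxes have the expected volume. *)
Lemma lebesgue_rV_box (R : realType) q (a b : 'rV[R]_q) :
  (forall j, a 0 j <= b 0 j) ->
  lebesgue_rV (Dom b a) = (\prod_j (b 0 j - a 0 j))%:E.
Proof.
elim: q a b => [|q IH] a b ab /=.
  rewrite big_ord0 indicE mem_set//; split=> -[]//.
set a' : 'rV[R]_q := \row_j a 0 (lift ord0 j).
set b' : 'rV[R]_q := \row_j b 0 (lift ord0 j).
have ab' j : a' 0 j <= b' 0 j by rewrite !mxE.
rewrite big_ord_recl.
transitivity (\int[@lebesgue_measure R]_(x in [set: R])
  ((\prod_j (b' 0 j - a' 0 j))%:E * (\1_(`]a 0 ord0, b 0 ord0[) x)%:E))%E.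
  apply: eq_integral => x _; rewrite -IH// indicE.
  have E0 v : (row_mx (x%:M : 'rV[R]_1) v : 'rV_(1 + q)) 0 (ord0 : 'I_q.+1) = x.
    rewrite (_ : (ord0 : 'I_q.+1) = lshift q (ord0 : 'I_1)); last exact/val_inj.
    by rewrite row_mxEl mxE eqxx.
  have E1 v (j : 'I_q) : (row_mx (x%:M : 'rV[R]_1) v : 'rV_(1 + q)) 0 (lift ord0 j : 'I_q.+1) = v 0 j.
    rewrite (_ : (lift ord0 j : 'I_q.+1) = rshift 1 j); last exact/val_inj.
    by rewrite row_mxEr.
  case: (boolP (x \in _)) => [|/negP]; rewrite inE/= in_itv/= => xab.
    rewrite mule1; congr lebesgue_rV; apply/seteqP; split => v /= [h1 h2]; split => j.
    - by move: (h1 (lift ord0 j)); rewrite E1 mxE.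
    - by move: (h2 (lift ord0 j)); rewrite E1 mxE.
    - case: (unliftP ord0 j) => [j'|] ->; last by rewrite E0; case/andP: xab.
      by rewrite E1; move: (h1 j'); rewrite mxE.
    - case: (unliftP ord0 j) => [j'|] ->; last by rewrite E0; case/andP: xab.
      by rewrite E1; move: (h2 j'); rewrite mxE.
  rewrite mule0 -[RHS](lebesgue_rV0 R q); congr lebesgue_rV; apply/seteqP; split => v //= [h1 h2].
  by apply: xab; move: (h1 ord0) (h2 ord0); rewrite E0 => -> ->.
rewrite ge0_integralZl_EFin//; last 2 first.
- by apply/measurable_EFinP; exact: measurable_indic.
- by rewrite prodr_ge0// => j _; rewrite subr_ge0.
rewrite integral_indic// setIT.
rewrite [X in (_ * X)%E](lebesgue_measure_itv `]a 0 ord0, b 0 ord0[%R)/= lte_fin.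
under eq_bigr do rewrite !mxE.
case: ltP => h; first by rewrite -EFinB -EFinM mulrC.
have -> : b 0 ord0 = a 0 ord0 by apply/eqP; rewrite eq_le h ab.
by rewrite subrr mul0r mule0.
Qed.

(* Main.v *)
Require Import Defs.
From mathcomp Require Import all_boot all_order all_algebra.
From mathcomp Require Import all_classical all_reals all_analysis.
From mathcomp Require Import measurable_realfun lra.
Set Implicit Arguments.
Unset Strict Implicit.
Unset Printing Implicit Defensive.
Import Order.TTheory GRing.Theory Num.Theory.
Import numFieldNormedType.Exports.
Local Open Scope classical_set_scope.
Local Open Scope ring_scope.

(** Moving one coordinate y_k of a point of a finite set changes the
hypervolume by the volume of a slab orthogonal to the k-th axis. As long as the
moving coordinate crosses no k-th coordinate of another point or of the
reference point, the slab is a product: its base, in the projected space, is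
the part dominated by y_{-k} and by no p_{-k} with p_k at or below the lower
end of the slab ([HVC_shift_coord]). The hypervolume is therefore piecewise affine in every
coordinate, and its slopes are again hypervolume contributions, one dimension
lower ([HVC_near_left], [HVC_near_right], [HVC_near]).

All the derivatives follow from these slopes. A function that is differentiable
at a point and affine on one side of it has the slope on that side as its
derivative ([derive_near]). On the k-line of y^(i), the first partial
derivative is constant just to the right of the point, so its own derivative,
if any, is 0. For l <> k one uses the left slopes. The left slope at y_k
involves the points with p_k < y_k, a strict inequality, even if there are
ties; this matches the index set I(Y, i, k). On the l-line of y^(i), the first
partial derivative is thus minus a contribution in dimension m-1 in which only
the point y^(i)_{-k} moves, and the same statement applies to it. The two signs
cancel. For generic coordinates the left and right slopes agree, hence the
derivatives exist.

The iterated integral that defines the volume is additive on the sets that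
matter here because each of them is a union of cells of a finite grid
([cellular]): the volume of its slices is then a step function of the first
coordinate, hence measurable. The slab has a product volume by induction on the
dimension, slice by slice, without exchanging integrals
([lebesgue_rV_cylinder]). *)

(** * Unions of cells of a finite grid *)

Lemma set_seq_cons (T : eqType) (x : T) (s : seq T) :
  [set` x :: s] = x |` [set` s].
Proof. by apply/seteqP; split=> y /=; rewrite inE => /predU1P. Qed.

Section CellularSets.
Context {R : realType}.
Implicit Types (s : seq R) (q : nat).

(** The position of x relative to the breakpoints s; two reals with the same
[cell] are the same breakpoint or lie in the same open interval between
breakpoints. *)
Definition cell s (x : R) : seq (bool * bool) := [seq (x < c, c < x) | c <- s].

Lemma cell_catP s1 s2 (x y : R) :
  cell (s1 ++ s2) x = cell (s1 ++ s2) y <->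
  cell s1 x = cell s1 y /\ cell s2 x = cell s2 y.
Proof.
rewrite /cell !map_cat; split=> [/eqP|[-> ->]//].
by rewrite eqseq_cat ?size_map// => /andP[/eqP -> /eqP ->].
Qed.

Lemma cell_lt s (c x y : R) : c \in s -> cell s x = cell s y ->
  (x < c) = (y < c) /\ (c < x) = (c < y).
Proof. by move=> cs /eq_in_map /(_ c cs) [-> ->]. Qed.

Lemma measurable_fun_cell d (T : measurableType d) s
    (g : seq (bool * bool) -> T) :
  measurable_fun [set: R] (fun x => g (cell s x)).
Proof.
elim: s g => [|c s IH] g /=; first exact: measurable_cst.
have -> : (fun x => g ((x < c, c < x) :: cell s x)) = fun x =>
    if x < c then
      if c < x then g ((true, true) :: cell s x)
      else g ((true, false) :: cell s x)
    else
      if c < x then g ((false, true) :: cell s x)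
      else g ((false, false) :: cell s x).
  by apply/funext => x /=; case: (x < c); case: (c < x).
apply: measurable_fun_ifT; first exact: measurable_fun_ltr.
  apply: measurable_fun_ifT; first exact: measurable_fun_ltr.
    exact: (IH (fun b => g ((true, true) :: b))).
  exact: (IH (fun b => g ((true, false) :: b))).
apply: measurable_fun_ifT; first exact: measurable_fun_ltr.
  exact: (IH (fun b => g ((false, true) :: b))).
exact: (IH (fun b => g ((false, false) :: b))).
Qed.

(** Factoring f through [cell s], which takes finitely many values with
measurable fibers, reduces measurability to finitely many case distinctions on
the breakpoints. *)
Lemma measurable_fun_cell_invariant d (T : measurableType d) s (f : R -> T) :
  (forall x y, cell s x = cell s y -> f x = f y) -> measurable_fun [set: R] f.
Proof.
move=> fs.
(* The default 0 is never returned: the fiber contains x. *)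
have -> : f = fun x => f (xget 0 [set y | cell s y = cell s x]).
  apply/funext => x; apply: fs.
  by case: xgetP => [y _ /= ->//|/(_ x)/= []].
exact: (measurable_fun_cell _ (fun b => f (xget 0 [set y | cell s y = b]))).
Qed.

(** The same breakpoints serve for all coordinates, so that the slices of a
saturated set are saturated for the same s. *)
Definition saturated q s (A : set 'rV[R]_q) := forall x y : 'rV[R]_q,
  (forall j, cell s (x 0 j) = cell s (y 0 j)) -> A x -> A y.

Definition cellular q (A : set 'rV[R]_q) := exists s, saturated s A.

Lemma saturated_catl q s1 s2 (A : set 'rV[R]_q) :
  saturated s1 A -> saturated (s1 ++ s2) A.
Proof. by move=> sA x y xy; apply: sA => j; have /cell_catP[] := xy j. Qed.

Lemma saturated_catr q s1 s2 (A : set 'rV[R]_q) :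
  saturated s2 A -> saturated (s1 ++ s2) A.
Proof. by move=> sA x y xy; apply: sA => j; have /cell_catP[] := xy j. Qed.

Lemma cellular0 q : cellular (@set0 'rV[R]_q).
Proof. by exists [::]. Qed.

Lemma cellularC q (A : set 'rV[R]_q) : cellular A -> cellular (~` A).
Proof.
case=> s sA; exists s => x y xy nAx Ay; apply: nAx.
by apply: sA Ay => j; rewrite xy.
Qed.

Lemma cellularU q (A B : set 'rV[R]_q) :
  cellular A -> cellular B -> cellular (A `|` B).
Proof.
move=> [s sA] [t tB]; exists (s ++ t) => x y xy [/(saturated_catl sA xy)|].
  by left.
by move/(saturated_catr tB xy); right.
Qed.

Lemma cellularD q (A B : set 'rV[R]_q) :
  cellular A -> cellular B -> cellular (A `\` B).
Proof.
move=> cA cB; rewrite setDE -[_ `&` _]setCK setCI setCK.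
by apply/cellularC/cellularU => //; exact: cellularC.
Qed.

Lemma cellular_bigcup q (P : set 'rV[R]_q) (F : 'rV[R]_q -> set 'rV[R]_q) :
  finite_set P -> (forall p, cellular (F p)) ->
  cellular (\bigcup_(p in P) F p).
Proof.
move=> /finite_seqP[s ->] cF; elim: s => [|p s IH].
  by rewrite set_nil bigcup_set0; exact: cellular0.
by rewrite set_seq_cons bigcup_setU1; exact: cellularU.
Qed.

Lemma cellular_Dom q (r y : 'rV[R]_q) : cellular (Dom r y).
Proof.
exists ([seq y 0 j | j <- enum 'I_q] ++ [seq r 0 j | j <- enum 'I_q]).
move=> x z xz [yx xr]; split=> j; have /cell_catP[xy xr'] := xz j.
  have [_ <-] := cell_lt (map_f (y 0) (mem_enum 'I_q j)) xy; exact: yx.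
have [<- _] := cell_lt (map_f (r 0) (mem_enum 'I_q j)) xr'; exact: xr.
Qed.

(** * Additivity of the iterated volume *)

Definition slice q (A : set 'rV[R]_q.+1) (x : R) : set 'rV[R]_q :=
  [set v | A (row_mx (x%:M : 'rV[R]_1) v)].

Lemma row_mx0 q (x : R) (v : 'rV[R]_q) :
  (row_mx (x%:M : 'rV[R]_1) v : 'rV[R]_q.+1) 0 ord0 = x.
Proof.
rewrite (_ : (ord0 : 'I_q.+1) = lshift q (ord0 : 'I_1)); last exact/val_inj.
by rewrite (row_mxEl (x%:M : 'rV[R]_1)) mxE eqxx.
Qed.

Lemma row_mx_lift q (x : R) (v : 'rV[R]_q) j :
  (row_mx (x%:M : 'rV[R]_1) v : 'rV[R]_q.+1) 0 (lift ord0 j) = v 0 j.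
Proof.
rewrite (_ : lift ord0 j = rshift 1 j); last exact/val_inj.
by rewrite (row_mxEr (x%:M : 'rV[R]_1)).
Qed.

Lemma saturated_slice q s (A : set 'rV[R]_q.+1) (x : R) :
  saturated s A -> saturated s (slice A x).
Proof.
move=> sA v w vw; apply: sA => j.
by case: (unliftP ord0 j) => [j'|] ->; rewrite ?row_mx_lift// !row_mx0.
Qed.

Lemma cellular_slice q (A : set 'rV[R]_q.+1) x : cellular A -> cellular (slice A x).
Proof. by case=> s sA; exists s; exact: saturated_slice. Qed.

Lemma slice_cell q s (A : set 'rV[R]_q.+1) (x y : R) :
  saturated s A -> cell s x = cell s y -> slice A x = slice A y.
Proof.
move=> sA xy; apply/seteqP; split=> v; apply: sA => j;
  by case: (unliftP ord0 j) => [j'|] ->; rewrite ?row_mx_lift// !row_mx0.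
Qed.

(** This is the measurability that the additivity of the iterated integral
needs. *)
Lemma measurable_slice q (A : set 'rV[R]_q.+1) : cellular A ->
  measurable_fun [set: R] (fun x => lebesgue_rV (slice A x)).
Proof.
case=> s sA; apply: (@measurable_fun_cell_invariant _ _ s) => x y xy.
by rewrite (slice_cell sA xy).
Qed.

Lemma lebesgue_rV_ge0 q (A : set 'rV[R]_q) : (0 <= lebesgue_rV A)%E.
Proof.
elim: q A => [|q IH] A /=; first by rewrite lee_fin.
by apply: integral_ge0 => x _; exact: IH.
Qed.

Lemma lebesgue_rVU q (A B : set 'rV[R]_q) : cellular A -> cellular B ->
  A `&` B = set0 -> lebesgue_rV (A `|` B) = (lebesgue_rV A + lebesgue_rV B)%E.
Proof.
elim: q A B => [|q IH] A B cA cB AB /=.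
  rewrite -EFinD !indicE; congr (_%:E); rewrite in_setU.
  have [/set_mem A0|] := boolP (0 \in A); last by rewrite add0r.
  have [/set_mem B0|] := boolP (0 \in B); last by rewrite addr0.
  by have : (A `&` B) 0 by []; rewrite AB.
rewrite -ge0_integralD//.
- apply: eq_integral => x _.
  by apply: (IH (slice A x) (slice B x)); do ?exact: cellular_slice;
     rewrite -subset0 => v /= ABv; have : (A `&` B) _ := ABv; rewrite AB.
- by move=> x _; exact: lebesgue_rV_ge0.
- exact: measurable_slice.
- by move=> x _; exact: lebesgue_rV_ge0.
- exact: measurable_slice.
Qed.

Lemma lebesgue_rVD q (A B : set 'rV[R]_q) : cellular A -> cellular B ->
  B `<=` A -> lebesgue_rV A = (lebesgue_rV B + lebesgue_rV (A `\` B))%E.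
Proof.
move=> cA cB BA; rewrite -lebesgue_rVU//; last by rewrite setDE setICA setICr setI0.
  by rewrite setDUK.
exact: cellularD.
Qed.

Lemma le_lebesgue_rV q (A B : set 'rV[R]_q) : cellular A -> cellular B ->
  A `<=` B -> (lebesgue_rV A <= lebesgue_rV B)%E.
Proof. by move=> cA cB AB; rewrite (lebesgue_rVD cB cA AB) leeDl// lebesgue_rV_ge0. Qed.

Lemma col'0_row_mx q (x : R) (v : 'rV[R]_q) :
  col' ord0 (row_mx (x%:M : 'rV[R]_1) v : 'rV[R]_q.+1) = v.
Proof. by apply/rowP => j; rewrite mxE row_mx_lift. Qed.

Lemma col'_lift_row_mx q (k : 'I_q.+1) (x : R) (v : 'rV[R]_q.+1) :
  col' (lift ord0 k) (row_mx (x%:M : 'rV[R]_1) v : 'rV[R]_q.+2) =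
  row_mx (x%:M : 'rV[R]_1) (col' k v) :> 'rV[R]_q.+1.
Proof.
apply/rowP => j; rewrite mxE.
case: (unliftP ord0 j) => [j'|] ->; last first.
  rewrite row_mx0 (_ : lift (lift ord0 k) ord0 = ord0 :> 'I_q.+2).
    by rewrite row_mx0.
  exact: val_inj.
rewrite row_mx_lift [RHS]mxE.
rewrite (_ : lift (lift ord0 k) (lift ord0 j') = lift ord0 (lift k j') :> 'I_q.+2).
  by rewrite row_mx_lift.
by apply/val_inj; rewrite /= /bump/= !add1n ltnS addnS.
Qed.

Lemma lebesgue_rV_cylinder0 q (I : set R) (B : set 'rV[R]_q) :
  measurable I ->
  lebesgue_rV [set x : 'rV[R]_q.+1 | I (x 0 ord0) /\ B (col' ord0 x)] =
  (lebesgue_measure I * lebesgue_rV B)%E.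
Proof.
move=> mI; transitivity (\int[@lebesgue_measure R]_(x in [set: R])
    (lebesgue_rV B * (\1_I x)%:E))%E.
  apply: eq_integral => x _; rewrite indicE.
  have [/set_mem xI|/negP xI] := boolP (x \in I).
    rewrite mule1; congr lebesgue_rV; apply/seteqP; split => v /=;
      by rewrite row_mx0 col'0_row_mx// => -[].
  rewrite mule0 -[RHS](lebesgue_rV0 R q); congr lebesgue_rV.
  rewrite -subset0 => v /=; rewrite row_mx0 col'0_row_mx => -[Ix _].
  by apply: xI; rewrite inE.
rewrite ge0_integralZl//.
- by rewrite integral_indic// setIT muleC.
- by apply/measurable_EFinP; exact: measurable_indic.
- exact: lebesgue_rV_ge0.
Qed.

(** The distinguished axis need not be the first integration variable: if k is a
later axis, every slice is a cylinder over a slice of B, and the factor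
[lebesgue_measure I] comes out of the integral. *)
Lemma lebesgue_rV_cylinder q (k : 'I_q.+1) (I : set R) (B : set 'rV[R]_q) :
  measurable I -> cellular B ->
  lebesgue_rV [set x : 'rV[R]_q.+1 | I (x 0 k) /\ B (col' k x)] =
  (lebesgue_measure I * lebesgue_rV B)%E.
Proof.
move=> mI; elim: q k B => [|q IH] k B cB; case: (unliftP ord0 k) => [k' ->|->].
- by case: k'.
- exact: lebesgue_rV_cylinder0.
- rewrite [RHS]/= -ge0_integralZl//.
  + apply: eq_integral => x _; apply: etrans (IH k' (slice B x) (cellular_slice x cB)).
    by apply: (congr1 (@lebesgue_rV R q.+1)); apply/seteqP; split=> v /=;
      rewrite row_mx_lift col'_lift_row_mx.
  + exact: measurable_slice.
  + by move=> x _; exact: lebesgue_rV_ge0.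
- exact: lebesgue_rV_cylinder0.
Qed.

End CellularSets.

(** * Hypervolume contributions *)

Section Contribution.
Context {R : realType}.
Implicit Types (q : nat).

Lemma lebesgue_rV_Dom_lty q (r y : 'rV[R]_q) : (lebesgue_rV (Dom r y) < +oo)%E.
Proof.
have [yr|/existsNP[j yr]] := pselect (forall j, y 0 j <= r 0 j).
  by rewrite lebesgue_rV_box// ltry.
rewrite (_ : Dom r y = set0) ?lebesgue_rV0//.
rewrite -subset0 => x [yx xr]; apply: yr.
exact: ltW (lt_trans (yx j) (xr j)).
Qed.

Lemma lebesgue_rV_bigcup_Dom_lty q (r : 'rV[R]_q) (P : set 'rV[R]_q) :
  finite_set P -> (lebesgue_rV (\bigcup_(y in P) Dom r y) < +oo)%E.
Proof.
move=> /finite_seqP[s ->]; elim: s => [|p s IH].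
  by rewrite set_nil bigcup_set0 lebesgue_rV0.
have cU := cellular_bigcup (finite_seq s) (cellular_Dom r).
have cp := cellular_Dom r p.
rewrite set_seq_cons bigcup_setU1.
rewrite (lebesgue_rVD (cellularU cp cU) cU (@subsetUr _ _ _)) setDUl setDv setU0.
rewrite lte_add_pinfty//; apply: le_lt_trans (lebesgue_rV_Dom_lty r p).
apply: le_lebesgue_rV => //; exact: cellularD.
Qed.

(** In the extreme case a + h = b the right endpoint is lost, at no cost in
measure. *)
Lemma lebesgue_measure_strip (a h b : R) : 0 <= h -> a + h <= b ->
  let I := [set x | a < x <= a + h /\ x < b] in
  measurable I /\ lebesgue_measure I = h%:E.
Proof.
move=> h0; rewrite le_eqVlt => /predU1P[<-|ahb] /=.
  have -> : [set x | a < x <= a + h /\ x < a + h] = `]a, a + h[%classic.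
    apply/seteqP; split=> x /=; rewrite in_itv/=; first by move=> [/andP[-> _] ->].
    by move=> /andP[-> xh]; rewrite ltW.
  split; first exact: measurable_itv.
  rewrite lebesgue_measure_itv/= lte_fin ltrDl; case: ltP => h'.
    by rewrite -EFinB addrAC subrr add0r.
  by congr (_%:E); apply/eqP; rewrite eq_le h0.
have -> : [set x | a < x <= a + h /\ x < b] = `]a, a + h]%classic.
  apply/seteqP; split=> x /=; rewrite in_itv/=; first by case.
  by move=> /[dup] xah /andP[_ xh]; split=> //; exact: le_lt_trans ahb.
split; first exact: measurable_itv.
rewrite lebesgue_measure_itv/= lte_fin ltrDl; case: ltP => h'.
  by rewrite -EFinB addrAC subrr add0r.
by congr (_%:E); apply/eqP; rewrite eq_le h0.
Qed.

Lemma HV_bigcup q (r : 'rV[R]_q) P :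
  HV r P = fine (lebesgue_rV (\bigcup_(y in P) Dom r y)).
Proof.
congr (fine (lebesgue_rV _)); apply/seteqP; split=> x.
  by move=> [y [Py yx xr]]; exists y.
by move=> [y Py [yx xr]]; exists y.
Qed.

(** Both hypervolumes are finite, so the truncation [fine] in [HV] is harmless
and the difference is that of the actual volumes. *)
Lemma HVC_lebesgue q (r y : 'rV[R]_q) (P : set 'rV[R]_q) : finite_set P ->
  (HVC r y P)%:E = lebesgue_rV (Dom r y `\` \bigcup_(x in P) Dom r x).
Proof.
move=> fP; rewrite /HVC !HV_bigcup.
have cP := cellular_bigcup fP (cellular_Dom r).
rewrite bigcup_setU bigcup_set1.
have lP := lebesgue_rV_bigcup_Dom_lty r fP.
have D0 : (0 <= lebesgue_rV (Dom r y `\` \bigcup_(x in P) Dom r x))%E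
  by exact: lebesgue_rV_ge0.
have lD : (lebesgue_rV (Dom r y `\` \bigcup_(x in P) Dom r x) < +oo)%E.
  apply: le_lt_trans (lebesgue_rV_Dom_lty r y).
  apply: le_lebesgue_rV; [|exact: cellular_Dom|exact: subDsetl].
  exact: cellularD (cellular_Dom r y) cP.
rewrite (lebesgue_rVD _ cP); [|exact: cellularU cP (cellular_Dom r y)|exact: subsetUl].
rewrite setDUl setDv set0U fineD ?ge0_fin_numE ?lebesgue_rV_ge0//.
by rewrite addrAC subrr add0r fineK// ge0_fin_numE.
Qed.

Lemma dominates_col' q (k : 'I_q.+1) (x y : 'rV[R]_q.+1) :
  dominates x y <-> x 0 k < y 0 k /\ dominates (col' k x) (col' k y).
Proof.
split=> [xy|[xyk xy] j]; first by split=> // j; rewrite !mxE.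
case: (unliftP k j) => [j'|] ->//.
by have := xy j'; rewrite !mxE.
Qed.

Definition shift_coord q (k : 'I_q) (t : R) (z : 'rV[R]_q) : 'rV[R]_q :=
  z + t *: delta_mx 0 k.

Lemma col'_shift_coord q (k : 'I_q) t (z : 'rV[R]_q) :
  col' k (shift_coord k t z) = col' k z.
Proof.
by apply/rowP => j; rewrite !mxE eqxx/= eq_sym (negbTE (neq_lift _ _)) mulr0 addr0.
Qed.

Lemma shift_coordE q (k : 'I_q) t (z : 'rV[R]_q) j :
  (shift_coord k t z) 0 j = z 0 j + (if j == k then t else 0).
Proof. by rewrite !mxE eqxx/=; case: (j == k); rewrite ?mulr1 ?mulr0. Qed.

(** Moving z by h along axis k loses the region with k-th coordinate in
]z_k, z_k + h]. There, a point p with the gap property dominates x in the k-th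
coordinate iff p_k <= z_k, whatever x_k is; so the region is a cylinder. *)
Lemma HVC_shift_coord q (k : 'I_q) (r z : 'rV[R]_q) (P : set 'rV[R]_q) (h : R) :
  finite_set P ->
  0 <= h -> z 0 k + h <= r 0 k ->
  (forall p, P p -> p 0 k < z 0 k + h -> p 0 k <= z 0 k) ->
  HVC r z P - HVC r (shift_coord k h z) P =
  h * HVC (col' k r) (col' k z) [set col' k p | p in [set p | P p /\ p 0 k <= z 0 k]].
Proof.
case: q k r z P => [[]//|q] k r z P fP h0 zhr Pk.
set Q := [set _ | _ in _].
have fQ : finite_set Q.
  by apply/finite_image/(sub_finite_set _ fP) => p [].
set w := shift_coord k h z.
have wk : w 0 k = z 0 k + h by rewrite shift_coordE eqxx.
have wc : col' k w = col' k z by exact: col'_shift_coord.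
set U := \bigcup_(p in P) Dom r p.
set V := \bigcup_(p in Q) Dom (col' k r) p.
(* The extent of the slab along axis k. *)
pose I := [set x | z 0 k < x <= z 0 k + h /\ x < r 0 k].
have mI : measurable I /\ lebesgue_measure I = h%:E.
  exact: lebesgue_measure_strip.
have cU : cellular U by exact: cellular_bigcup fP (cellular_Dom r).
have cV : cellular V by exact: cellular_bigcup fQ (cellular_Dom _).
have : lebesgue_rV (Dom r z `\` U) =
  (lebesgue_rV (Dom r w `\` U) + h%:E * lebesgue_rV (Dom (col' k r) (col' k z) `\` V))%E.
  rewrite (@lebesgue_rVD _ _ _ (Dom r w `\` U)).
  - rewrite -mI.2 -(lebesgue_rV_cylinder k)//; last 2 first.
    + exact: mI.1.
    + exact: cellularD (cellular_Dom _ _) cV.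
    congr (_ + lebesgue_rV _)%E; apply/seteqP; split=> x /=.
      move=> [[[/(dominates_col' k)[zx zx'] /(dominates_col' k)[xr xr']] nU] nw].
      have xh : x 0 k <= z 0 k + h.
        rewrite leNgt; apply/negP => hx; apply: nw; split=> //; split.
          by apply/(dominates_col' k); rewrite wk wc.
        by apply/(dominates_col' k).
      split; first by rewrite /I /= zx xh.
      split; first by [].
      move=> [_ [p [Pp pz] <-] [px _]]; apply: nU; exists p => //; split.
        by apply/(dominates_col' k); split=> //; exact: le_lt_trans zx.
      by apply/(dominates_col' k).
    move=> [[/andP[zx xh] xr] [[zx' xr'] nV]]; split; first split.
    + by split; apply/(dominates_col' k).
    + move=> [p Pp [/(dominates_col' k)[px px'] _]]; apply: nV.
      exists (col' k p) => //; exists p => //; split=> //.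
      by apply: Pk => //; exact: lt_le_trans px xh.
    + move=> [[/(dominates_col' k)[+ _] _] _]; rewrite wk => /lt_le_trans/(_ xh).
      by rewrite ltxx.
  - exact: cellularD (cellular_Dom _ _) cU.
  - exact: cellularD (cellular_Dom _ _) cU.
  - move=> x [[/(dominates_col' k)[wx wx'] xr] nU]; split=> //; split=> //.
    apply/(dominates_col' k); rewrite -wc; split=> //; apply: le_lt_trans wx.
    by rewrite wk lerDl.
rewrite /U /V -!HVC_lebesgue// -EFinM -EFinD => -[->].
by rewrite addrAC subrr add0r.
Qed.

End Contribution.

(** * One-sided slopes of a contribution *)

Section PiecewiseAffine.
Context {R : realType}.

Lemma near_avoid_finite (A : set R) (a : R) : finite_set A ->
  \forall h \near (0 : R), forall x, A x -> x != a -> `|h| < `|x - a|.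
Proof.
move=> /finite_seqP[s ->]; elim: s => [|x s IH]; first by near=> h.
have xN : \forall h \near (0 : R), x != a -> `|h| < `|x - a|.
  have [_|xa] := eqVneq x a; first by near=> h.
  have xa0 : 0 < `|x - a| by rewrite normr_gt0 subr_eq0.
  apply: filterS (nbhs0_lt xa0) => h hx _; exact: hx.
apply: filterS2 IH xN => h IH xN y /=.
by rewrite inE => /predU1P[->|]; [|exact: IH].
Unshelve. all: by end_near. Qed.

Lemma HVC_eq0 q (k : 'I_q) (r z : 'rV[R]_q) (P : set 'rV[R]_q) : finite_set P ->
  r 0 k <= z 0 k -> HVC r z P = 0.
Proof.
move=> fP rz; apply: EFin_inj; rewrite HVC_lebesgue// (_ : Dom r z = set0).
  by rewrite set0D lebesgue_rV0.
rewrite -subset0 => x [zx xr].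
by have := lt_trans (zx k) (xr k); rewrite ltNge rz.
Qed.

Lemma shift_coordK q (k : 'I_q) t (z : 'rV[R]_q) :
  shift_coord k (- t) (shift_coord k t z) = z.
Proof. by rewrite /shift_coord scaleNr addrK. Qed.

(** The contribution of z_{-k} to the projections of the points strictly below
z along axis k: minus the left slope of the contribution of z, provided
z_k <= r_k. *)
Definition HVC_face q (k : 'I_q) (r z : 'rV[R]_q) (P : set 'rV[R]_q) : R :=
  HVC (col' k r) (col' k z) [set col' k p | p in [set p | P p /\ p 0 k < z 0 k]].

(** This is [HVC_shift_coord] started from the moved point: the points with
p_k <= z_k + h are those with p_k < z_k when h < 0 is small, so ties
p_k = z_k are harmless on this side. *)
Lemma HVC_near_left q (k : 'I_q) (r z : 'rV[R]_q) (P : set 'rV[R]_q) :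
  finite_set P -> z 0 k <= r 0 k ->
  \forall h \near (0 : R), h < 0 ->
    HVC r (shift_coord k h z) P = HVC r z P + h * - HVC_face k r z P.
Proof.
move=> fP zr.
have := near_avoid_finite (z 0 k) (finite_image (fun p : 'rV[R]_q => p 0 k) fP).
apply: filterS => h avoid h0.
have gap p : P p -> p 0 k < z 0 k -> p 0 k <= z 0 k + h.
  move=> Pp pz; have := avoid _ (imageP _ Pp); rewrite lt_eqF// => /(_ isT).
  by rewrite ltr0_norm// ltr0_norm ?subr_lt0// => /ltW; rewrite opprB; lra.
set w := shift_coord k h z.
have wk : w 0 k = z 0 k + h by rewrite shift_coordE eqxx.
have zE : shift_coord k (- h) w = z by exact: shift_coordK.
have := @HVC_shift_coord R q k r w P (- h) fP; rewrite zE wk addrK oppr_ge0.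
move=> /(_ (ltW h0) zr gap); rewrite col'_shift_coord.
have -> : [set p | P p /\ p 0 k <= z 0 k + h] = [set p | P p /\ p 0 k < z 0 k].
  apply/seteqP; split=> p /= [Pp pz]; split=> //; last exact: gap.
  by lra.
rewrite /HVC_face; lra.
Qed.

(** The right slope can differ from the left one in case of ties, but
only its existence matters for the pure second derivative. *)
Lemma HVC_near_right q (k : 'I_q) (r z : 'rV[R]_q) (P : set 'rV[R]_q) :
  finite_set P -> exists c, \forall h \near (0 : R), 0 <= h ->
    HVC r (shift_coord k h z) P = HVC r z P + h * c.
Proof.
move=> fP; have [zr|rz] := ltP (z 0 k) (r 0 k); last first.
  exists 0; near=> h => h0; rewrite !(HVC_eq0 (k := k)) ?mulr0 ?addr0//.
  by rewrite shift_coordE eqxx; lra.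
exists (- HVC (col' k r) (col' k z)
  [set col' k p | p in [set p | P p /\ p 0 k <= z 0 k]]).
have zr0 : 0 < r 0 k - z 0 k by rewrite subr_gt0.
have := near_avoid_finite (z 0 k) (finite_image (fun p : 'rV[R]_q => p 0 k) fP).
apply: filterS2 (nbhs0_lt zr0) => h; rewrite /= => hr avoid h0.
rewrite ger0_norm// in hr avoid.
have zhr : z 0 k + h <= r 0 k by lra.
have gap p : P p -> p 0 k < z 0 k + h -> p 0 k <= z 0 k.
  move=> Pp pzh; rewrite leNgt; apply/negP => zp.
  have := avoid _ (imageP _ Pp); rewrite gt_eqF// => /(_ isT).
  by rewrite gtr0_norm ?subr_gt0//; lra.
have := HVC_shift_coord fP h0 zhr gap; lra.
Unshelve. all: by end_near. Qed.

Lemma HVC_near q (k : 'I_q) (r z : 'rV[R]_q) (P : set 'rV[R]_q) :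
  finite_set P -> z 0 k != r 0 k -> (forall p, P p -> p 0 k != z 0 k) ->
  \forall h \near (0 : R),
    HVC r (shift_coord k h z) P = HVC r z P +
     h * (if z 0 k < r 0 k then - HVC_face k r z P else 0).
Proof.
move=> fP zr Pz; have [{}zr|rz|/eqP] := ltgtP (z 0 k) (r 0 k); last first.
- by rewrite (negbTE zr).
- have zr0 : 0 < z 0 k - r 0 k by rewrite subr_gt0.
  apply: filterS (nbhs0_lt zr0) => h /=; rewrite ltr_norml => /andP[hr _].
  rewrite !(HVC_eq0 (k := k)) ?mulr0 ?addr0// ?shift_coordE ?eqxx; lra.
have zr0 : 0 < r 0 k - z 0 k by rewrite subr_gt0.
have := near_avoid_finite (z 0 k) (finite_image (fun p : 'rV[R]_q => p 0 k) fP).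
have left := HVC_near_left fP (ltW zr).
have hr : \forall h \near (0 : R), `|h| < r 0 k - z 0 k by exact: nbhs0_lt.
move=> avoid; refine (filterS3 _ _ left hr avoid) => h /= {}left {}hr {}avoid.
have [/left//|h0|->] := ltgtP h 0; last first.
  by rewrite mul0r addr0 /shift_coord scale0r addr0.
rewrite gtr0_norm// in hr avoid.
have zhr : z 0 k + h <= r 0 k by lra.
have gap p : P p -> p 0 k < z 0 k + h -> p 0 k <= z 0 k.
  move=> Pp pzh; rewrite leNgt; apply/negP => zp.
  have := avoid _ (imageP _ Pp); rewrite gt_eqF// => /(_ isT).
  by rewrite gtr0_norm ?subr_gt0//; lra.
have := HVC_shift_coord fP (ltW h0) zhr gap; rewrite /HVC_face.
have -> : [set p | P p /\ p 0 k <= z 0 k] = [set p | P p /\ p 0 k < z 0 k].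
  apply/seteqP; split=> p /= [Pp pz]; split=> //; last exact: ltW.
  by rewrite lt_neqAle Pz.
lra.
Qed.

(** The limit of the difference quotients may be computed along any filter F
finer than the punctured neighborhoods, for instance on one side. *)
Lemma derive_near (V : normedModType R) (f : V -> R) (x v : V) (c : R)
    (F : set_system R) :
  ProperFilter F -> F `=>` 0^' -> derivable f x v ->
  (\forall h \near F, f (x + h *: v) = f x + h * c) -> 'D_v f x = c.
Proof.
move=> FF F0 df Fc.
have dF : h^-1 *: ((f \o shift x) (h *: v) - f x) @[h --> F] --> 'D_v f x.
  by apply: cvg_trans df; exact: cvg_app.
apply: (cvg_unique _ dF) => //.
have n0 : \forall h \near F, h != 0 by apply: F0; exact: withinT.
apply: cvg_near_cst; apply: (filterS2 _ _ Fc n0) => h fh h0 /=.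
by rewrite [h *: v + _]addrC fh addrAC subrr add0r /GRing.scale/= mulrA mulVf// mul1r.
Qed.

Lemma is_derive_near (V : normedModType R) (f : V -> R) (x v : V) (c s : R) :
  (\forall t \near s, f (x + t *: v) = f x + t * c) ->
  is_derive (x + s *: v) v f c.
Proof.
move=> fx; have fs := nbhs_singleton fx.
have fN : \forall h \near 0^', f (x + s *: v + h *: v) = f (x + s *: v) + h * c.
  have sh : s + h @[h --> 0] --> s.
    by rewrite -[X in _ --> X]addr0; apply: cvgD; [exact: cvg_cst|exact: cvg_id].
  have sx : \forall h \near (0 : R), f (x + (s + h) *: v) = f x + (s + h) * c.
    exact: (sh _ fx).
  apply: nbhs_dnbhs; apply: filterS sx => h /= fh.
  by rewrite fs -addrA -scalerDl fh mulrDl addrA.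
have df : derivable f (x + s *: v) v.
  have n0 : \forall h \near (0 : R)^', h != 0 by exact: withinT.
  apply: (is_cvg_near_cst c); apply: (filterS2 _ _ fN n0) => h fh h0 /=.
  by rewrite [h *: v + _]addrC fh addrAC subrr add0r /GRing.scale/= mulrA mulVf// mul1r.
by split=> //; apply: (derive_near _ _ df fN).
Qed.
End PiecewiseAffine.

(** * Partial derivatives of the hypervolume *)

Lemma at_left_dnbhs (R : realType) (a : R) : a^'- --> a^'.
Proof.
move=> A dA; have {}dA : \forall x \near a, x != a -> A x by exact: dA.
have : \forall x \near a, x < a -> A x.
  by apply: filterS dA => x + xa; apply; rewrite lt_eqF.
by [].
Qed.

Lemma at_right_dnbhs (R : realType) (a : R) : a^'+ --> a^'.
Proof.
move=> A dA; have {}dA : \forall x \near a, x != a -> A x by exact: dA.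
have : \forall x \near a, a < x -> A x.
  by apply: filterS dA => x + xa; apply; rewrite gt_eqF.
by [].
Qed.

Section HypervolumeDerivatives.
Context {R : realType}.
Context (n m : nat) (r : 'rV[R]_m).
Implicit Types (Y : 'M[R]_(n, m)) (i : 'I_n) (k l : 'I_m).

Definition other_points Y i : set 'rV[R]_m :=
  [set row a Y | a in [set a | a != i]].

Lemma finite_other_points Y i : finite_set (other_points Y i).
Proof. exact/finite_image/finite_finset. Qed.

(** Only the second term depends on y^(i): the derivatives of [calH r] with
respect to y^(i) are those of a contribution. *)
Lemma calH_concat Y i : calH r (concat Y) =
  HV r (other_points Y i) + HVC r (row i Y) (other_points Y i).
Proof.
rewrite /calH /concat mxvecK /HVC addrC subrK; congr (HV r _).
apply/seteqP; split=> [_ [a _ <-]|_ [[a _ <-]|->]].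
- by have [->|ai] := eqVneq a i; [right|left; exists a].
- by exists a.
- by exists i.
Qed.

Lemma concat_move Y i k t :
  concat Y + t *: coord_dir i k = concat (Y + t *: delta_mx i k).
Proof. by rewrite /concat /coord_dir linearD linearZ/= mxvec_delta. Qed.

Lemma row_move Y i k t :
  row i (Y + t *: delta_mx i k) = shift_coord k t (row i Y).
Proof. by apply/rowP => j; rewrite !mxE !eqxx. Qed.

Lemma row_move_other Y i k t a : a != i ->
  row a (Y + t *: delta_mx i k) = row a Y.
Proof. by move=> ai; apply/rowP => j; rewrite !mxE (negbTE ai) mulr0 addr0. Qed.

Lemma other_points_move Y i k t :
  other_points (Y + t *: delta_mx i k) i = other_points Y i.
Proof.
by apply/seteqP; split=> _ [a ai <-]; exists a => //; rewrite row_move_other.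
Qed.

Lemma calH_move Y i k t : calH r (concat Y + t *: coord_dir i k) =
  calH r (concat Y) - HVC r (row i Y) (other_points Y i)
  + HVC r (shift_coord k t (row i Y)) (other_points Y i).
Proof.
by rewrite concat_move !(calH_concat _ i) other_points_move row_move addrK.
Qed.

(** The first-derivative formula, whenever the derivative exists: it must be the
left slope, and the bound Y i k <= r 0 k makes the slab on the left a genuine
one even if Y i k equals r 0 k. *)
Lemma partial_calH_left Y i k : Y i k <= r 0 k ->
  derivable (calH r) (concat Y) (coord_dir i k) ->
  partial i k (calH r) (concat Y) =
  - HVC_face k r (row i Y) (other_points Y i).
Proof.
move=> Yr dH; apply: (@derive_near _ _ _ _ _ _ 0^'-) => //.
  exact: at_left_dnbhs.
have Yr' : row i Y 0 k <= r 0 k by rewrite mxE.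
have L := HVC_near_left (finite_other_points Y i) Yr'.
apply: filterS L => h L h0.
by rewrite calH_move L// addrA subrK.
Qed.

Lemma generic_at_other Y i k : generic_at r Y i k ->
  (row i Y) 0 k != r 0 k /\
  forall p, other_points Y i p -> p 0 k != (row i Y) 0 k.
Proof.
by move=> [Yr Ya]; split=> [|_ [a ai <-]]; rewrite !mxE//; exact: Ya.
Qed.

Lemma calH_near Y i k : generic_at r Y i k ->
  \forall t \near (0 : R), calH r (concat Y + t *: coord_dir i k) =
    calH r (concat Y) + t * (if Y i k < r 0 k then
       - HVC_face k r (row i Y) (other_points Y i) else 0).
Proof.
move=> /generic_at_other[zr Pz].
have := HVC_near (finite_other_points Y i) zr Pz.
by apply: filterS => t H; rewrite calH_move H addrA subrK [row i Y 0 k]mxE.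
Qed.

Lemma is_derive_calH Y i k : generic_at r Y i k ->
  is_derive (concat Y) (coord_dir i k) (calH r) (if Y i k < r 0 k then
       - HVC_face k r (row i Y) (other_points Y i) else 0).
Proof.
move=> /calH_near/is_derive_near; by rewrite scale0r addr0.
Qed.

Lemma derivable2_diag Y i k : generic_at r Y i k ->
  derivable2 i k i k (calH r) (concat Y).
Proof.
move=> g; have := near_join (calH_near g).
set c := (if _ then _ else _) => H.
have D : \forall t \near (0 : R),
    is_derive (concat Y + t *: coord_dir i k) (coord_dir i k) (calH r) c.
  by apply: filterS H => t; exact: is_derive_near.
split; first by apply: filterS D => t [].
have c0 : partial i k (calH r) (concat Y) = c.
  by have [_] := nbhs_singleton D; rewrite scale0r addr0.
have : \forall t \near (0 : R),
    partial i k (calH r) (concat Y + t *: coord_dir i k) =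
    partial i k (calH r) (concat Y) + t * 0.
  by apply: filterS D => t [_]; rewrite mulr0 addr0 c0.
by move=> /is_derive_near []; rewrite scale0r addr0.
Qed.

(** Just to the right of the point the hypervolume is affine, with some slope c,
wherever y^(i)_k lies relative to the other points and to the reference point.
So the first partial derivative equals c there, and it equals c at the point
itself, where it is also the right-hand slope. *)
Lemma partial2_diag Y i k : derivable2 i k i k (calH r) (concat Y) ->
  partial i k (partial i k (calH r)) (concat Y) = 0.
Proof.
move=> [/nbhs_singleton dH dG]; rewrite scale0r addr0 in dH.
have [c C] := HVC_near_right k r (row i Y) (finite_other_points Y i).
have {}C : \forall h \near (0 : R), 0 <= h ->
    calH r (concat Y + h *: coord_dir i k) = calH r (concat Y) + h * c.
  by apply: filterS C => h C h0; rewrite calH_move C// addrA subrK.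
have c0 : partial i k (calH r) (concat Y) = c.
  apply: (@derive_near _ _ _ _ _ _ 0^'+ _ (@at_right_dnbhs R 0) dH).
  have Cr : \forall h \near (0 : R), 0 < h ->
      calH r (concat Y + h *: coord_dir i k) = calH r (concat Y) + h * c.
    by apply: filterS C => h C h0; apply/C/ltW.
  exact: Cr.
apply: (@derive_near _ _ _ _ _ _ 0^'+ _ (@at_right_dnbhs R 0) dG).
have Cr : \forall h \near (0 : R), 0 < h ->
    partial i k (calH r) (concat Y + h *: coord_dir i k) =
    partial i k (calH r) (concat Y) + h * 0.
  apply: filterS (near_join C) => h {}C h0; rewrite mulr0 addr0 c0.
  apply: derive_val; apply: is_derive_near.
  by apply: (filterS2 _ _ (lt_nbhsr h0) C) => t t0 {}C; apply/C/ltW.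
exact: Cr.
Qed.

End HypervolumeDerivatives.

(** * Mixed second derivatives *)

Section MixedDerivative.
Context {R : realType}.
Context (n m : nat) (r : 'rV[R]_m) (Y : 'M[R]_(n, m)) (i : 'I_n).
Context (k l : 'I_m) (p : 'I_m.-1) (kpl : lift k p = l).

Local Notation z := (col' k (row i Y)).

Definition face_points : set 'rV[R]_m.-1 := [set col' k x |
  x in [set x | other_points Y i x /\ x 0 k < (row i Y) 0 k]].

Lemma finite_face_points : finite_set face_points.
Proof.
apply: finite_image; apply: sub_finite_set (finite_other_points Y i).
by move=> x [].
Qed.

Lemma move_mixed t : (Y + t *: delta_mx i l) i k = Y i k.
Proof. by rewrite !mxE -kpl (negbTE (neq_lift _ _)) andbF mulr0 addr0. Qed.

(** Moving y^(i) along axis l changes neither the other points nor the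
comparisons along axis k, so the (m-1)-dimensional contribution is that of a
moving point to a fixed set. *)
Lemma HVC_face_move t :
  HVC_face k r (row i (Y + t *: delta_mx i l))
    (other_points (Y + t *: delta_mx i l) i) =
  HVC (col' k r) (shift_coord p t z) face_points.
Proof.
rewrite /HVC_face other_points_move [row i (_ + _) 0 k]mxE move_mixed row_move.
rewrite /face_points [row i Y 0 k]mxE; congr (HVC _ _ _).
by apply/rowP => j; rewrite !mxE -kpl (inj_eq lift_inj).
Qed.

Lemma generic_at_move t : generic_at r Y i k ->
  generic_at r (Y + t *: delta_mx i l) i k.
Proof.
move=> [Yr Ya]; split=> [|a ai]; rewrite move_mixed//.
by rewrite !mxE (negbTE ai) mulr0 addr0 Ya.
Qed.

Lemma partial2_mixed : Y i k <= r 0 k -> Y i l <= r 0 l ->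
  derivable2 i l i k (calH r) (concat Y) ->
  partial i l (partial i k (calH r)) (concat Y) =
  HVC_face p (col' k r) z face_points.
Proof.
move=> Ykr Ylr [dH dG].
have G : \forall t \near (0 : R),
    partial i k (calH r) (concat Y + t *: coord_dir i l) =
    - HVC (col' k r) (shift_coord p t z) face_points.
  apply: filterS dH => t; rewrite concat_move => dHt.
  by rewrite partial_calH_left ?move_mixed// HVC_face_move.
have G0 : partial i k (calH r) (concat Y) = - HVC (col' k r) z face_points.
  by have := nbhs_singleton G; rewrite /shift_coord !scale0r !addr0.
have zr : z 0 p <= (col' k r) 0 p by rewrite !mxE kpl.
apply: (@derive_near _ _ _ _ _ _ 0^'- _ (@at_left_dnbhs R 0) dG).
have L := HVC_near_left finite_face_points zr.
have Gl : \forall t \near (0 : R), t < 0 ->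
    partial i k (calH r) (concat Y + t *: coord_dir i l) =
    partial i k (calH r) (concat Y) + t * HVC_face p (col' k r) z face_points.
  by apply: (filterS2 _ _ G L) => t -> + t0 => -> //; rewrite G0; lra.
exact: Gl.
Qed.

Lemma derivable2_mixed : generic_at r Y i k -> generic_at r Y i l ->
  derivable2 i l i k (calH r) (concat Y).
Proof.
move=> gk gl.
have D t : is_derive (concat Y + t *: coord_dir i l) (coord_dir i k) (calH r)
    (if Y i k < r 0 k then - HVC (col' k r) (shift_coord p t z) face_points
     else 0).
  rewrite concat_move -HVC_face_move -(move_mixed t).
  exact/is_derive_calH/generic_at_move.
split; first by near=> t; have [] := D t.
have G t : partial i k (calH r) (concat Y + t *: coord_dir i l) =
    if Y i k < r 0 k then - HVC (col' k r) (shift_coord p t z) face_points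
    else 0 by have [] := D t.
have G0 := G 0; rewrite /shift_coord !scale0r !addr0 in G0.
suff [c C] : exists c, \forall t \near (0 : R),
    partial i k (calH r) (concat Y + t *: coord_dir i l) =
    partial i k (calH r) (concat Y) + t * c.
  by have [+ _] := is_derive_near C; rewrite scale0r addr0.
move: G G0; case: ltP => _ G G0; last first.
  by exists 0; near=> t; rewrite G G0 mulr0 addr0.
have [zr zP] : z 0 p != (col' k r) 0 p /\
    forall x, face_points x -> x 0 p != z 0 p.
  have [Ylr Ya] := gl; rewrite !mxE kpl; split=> //.
  by move=> _ [_ [[a ai <-] _] <-]; rewrite !mxE kpl Ya.
have := HVC_near finite_face_points zr zP; set c := (if _ then _ else _) => H.
by exists (- c); apply: filterS H => t H; rewrite G G0 H; lra.
Unshelve. all: by end_near. Qed.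

End MixedDerivative.

Lemma lift_drop m (k l : 'I_m) (p : 'I_m.-1) : l != k ->
  p = (if (l < k)%N then l : nat else l.-1) :> nat -> lift k p = l.
Proof.
move=> lk pE; apply: val_inj; rewrite /= /bump pE.
move: lk; rewrite -val_eqE/=; case: ltngtP => //= h _; first by rewrite leqNgt h.
by case: (l : nat) h => // l'; rewrite ltnS => ->.
Qed.

Theorem corollary4p1 (R : realType) (m n : nat) (r : 'rV[R]_m)
    (Y : 'M[R]_(n, m)) (i : 'I_n) (k : 'I_m) :
  [/\ (derivable2 i k i k (calH r) (concat Y) ->
         partial i k (partial i k (calH r)) (concat Y) = 0),
      (generic_at r Y i k -> derivable2 i k i k (calH r) (concat Y)) &
      forall (l : 'I_m) (p : 'I_m.-1),
        l != k ->
        p = (if (l < k)%N then l : nat else l.-1) :> nat ->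
        (* y' a is y^(a)_{-k}; Y' is the family of the y' a with a in J. *)
        let y' := fun a : 'I_n => col' k (row a Y) in
        let J := (i |: below [set: 'I_n] (fun a => row a Y) i k)%SET in
        let r'' := col' p (col' k r) in
        let z := col' p (y' i) in
        let P := [set col' p (y' a) | a in [set` below J y' i p]] in
        [/\ (Y i k <= r 0 k -> Y i l <= r 0 l ->
               derivable2 i l i k (calH r) (concat Y) ->
               partial i l (partial i k (calH r)) (concat Y) = HVC r'' z P),
            (generic_at r Y i k -> generic_at r Y i l ->
               derivable2 i l i k (calH r) (concat Y)) &
            (HVC r'' z P)%:E =
              lebesgue_rV (Dom r'' z `\` \bigcup_(x in P) Dom r'' x)]].
Proof.
split; [exact: partial2_diag|exact: derivable2_diag|].
move=> l p lk pE y' J r'' z P.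
have kpl := lift_drop lk pE.
have PE : P = [set col' p x |
    x in [set x | face_points Y i k x /\ x 0 p < y' i 0 p]].
  apply/seteqP; split=> [_ [a aJ <-]|_ [_ [[x [[a /= ai <-] ak] <-] ap] <-]].
    move: aJ; rewrite /= !inE => /andP[/orP[/eqP ->|ak] ap].
      by rewrite ltxx in ap.
    exists (y' a) => //; split=> //; exists (row a Y) => //; split=> //.
    by exists a => //=; apply: contraTneq ap => ->; rewrite ltxx.
  by exists a => //=; rewrite !inE ak ap orbT.
have fP : finite_set P by exact/finite_image/finite_finset.
split; last exact: HVC_lebesgue.
- by rewrite PE; exact: partial2_mixed kpl.
- exact: derivable2_mixed kpl.
Qed.
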